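(* Let $\omega\subset[0,1]$ satisfy $$\limsup_{k\to\infty}\frac{\log\left(-\log\gamma_k(\omega)\right)}{\log k}<2.$$ Then there exist $C>0$ and $\beta\in(0,1)$ such that for every $\Lambda\ge 1$ and every function of the form $v(x)=\sum_{k\in\mathbb{N},\,k^2\le\Lambda}v_k\sin(2\pi kx)$ with scalar coefficients $v_k$, $$\sup_{x\in[0,1]}|v(x)|\le\exp\left(C\Lambda^\beta\right)\sup_{x\in\omega}|v(x)|.$$
   Context: For $E\subset[0,1]$ and an integer $k\ge 1$, $$\gamma_k(E)=\sup_{\{x_i\}_{i=1}^k\subset E}\ \min_{1\le i\le k}\ \prod_{j\ne i}|x_i-x_j|.$$ If $\gamma_k(\omega)=0$, then $-\log\gamma_k(\omega)$ is understood as $+\infty$, so the hypothesis requires in particular $\gamma_k(\omega)>0$ for all large $k$. *)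

(* Defs.v *)
From HB Require Import structures.
From mathcomp Require Import all_boot all_order all_algebra.
From mathcomp Require Import all_classical all_reals all_analysis.
From mathcomp Require Import complex.
Set Implicit Arguments.
Unset Strict Implicit.
Unset Printing Implicit Defensive.
Import Order.TTheory GRing.Theory Num.Theory.
Local Open Scope classical_set_scope.
Local Open Scope ring_scope.

(* For points of [0, 1] every product is at most 1, so the default value 1 of
   the iterated minimum does not affect it. Since [sup set0 = 0], the value at
   [E = set0] and [k >= 1] is 0. *)
Definition gamma (R : realType) (E : set R) (k : nat) : R :=
  sup [set \big[Num.min/1]_(i < k) \prod_(j < k | j != i) `|x i - x j|
      | x in [set x : 'I_k -> R | forall i, E (x i)]].

(* [lne] is the logarithm on the extended reals, with [lne 0 = -oo] and
   [lne +oo = +oo]. *)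
Definition loglog_ratio (R : realType) (E : set R) (k : nat) : \bar R :=
  (lne (- lne (gamma E k)%:E) * ((ln k%:R)^-1)%:E)%E.

Definition sine_sum (R : realType) (Lambda : R) (c : nat -> R[i]) (x : R) : R[i] :=
  \sum_(k \in [set k : nat | k%:R ^+ 2 <= Lambda])
    c k * (sin (2 * pi * k%:R * x))%:C%C.

Definition sup_norm_on (R : realType) (A : set R) (v : R -> R[i]) : R :=
  sup [set Normc.normc (v x) | x in A].

(* Main.v *)
Require Import Defs.
From mathcomp Require Import all_boot all_order all_algebra.
From mathcomp Require Import all_classical all_reals all_analysis.
From mathcomp Require Import complex.
From mathcomp Require Import ring lra.
Import Order.TTheory GRing.Theory Num.Theory.
Local Open Scope classical_set_scope.
Local Open Scope ring_scope.

Set Implicit Arguments.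
Unset Strict Implicit.
Unset Printing Implicit Defensive.

(** The real part and the imaginary part of [v] are real sine sums [f] with the
    frequencies [1, ..., N], where [N] is the integer part of [sqrt Lambda]. Such an
    [f] extends to an entire function of exponential type [2 pi N], so it is
    nearly determined by its values at any [K] points once [K] is a large enough
    multiple of [N]; the quantity [gamma] measures how stably.

    The hypothesis provides [alpha < 2] such that, for all large [K], there are [K]
    points [x i] of [omega] whose products [\prod_(j != i) |x i - x j|] all exceed
    [expR (- K^alpha)] ([separated_points]). These products are the denominators of
    the Lagrange basis, so the interpolation polynomial of [f] at the [x i] is
    bounded on [[0, 1]] by [K expR (K^alpha)] times the supremum of [|f|] over
    [omega] ([lagrange_bound]). The interpolation error is at most
    [sup |f^(K)| / K!] ([interpolation_error], by iterating Rolle's theorem). To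
    bound the derivative by [f] itself, let [M] be the maximum of [|f|] on a
    regular grid of [2N + 1] points. Discrete orthogonality of the sines on
    that grid bounds every coefficient of [f] by [2M] ([sine_coef_bound]),
    hence [|f^(K)|] by [2 M N (2 pi N)^K]. For [K >= 64 N] the factorial wins and
    the error is at most [M / 2] ([interpolation_tail_le_half]). At the grid point
    where [M] is attained the error is absorbed into the left-hand side, which
    bounds [M], then the coefficients, then [f] everywhere
    ([real_sine_propagation]).

    The choice [K = A N], with [A] a constant that depends on [omega] only, turns
    [expR (K^alpha)] into [expR (C Lambda^(alpha / 2))]. *)

(** * Interpolation error *)

Lemma norm_sum_le (R : numDomainType) (n : nat) (F : 'I_n -> R) (C : R) :
  (forall k, `|F k| <= C) -> `|\sum_(k < n) F k| <= n%:R * C.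
Proof.
move=> FC; rewrite (le_trans (ler_norm_sum _ _ _))//.
have -> : n%:R * C = \sum_(k < n) C by rewrite sumr_const card_ord mulr_natl.
by apply: ler_sum.
Qed.

(** Rolle's theorem between consecutive zeros: along a sorted list of zeros of [f],
    the zeros of [df] found in the gaps come out sorted as well, which lets the
    statement be iterated. *)
Lemma rolle_path (R : realType) (f df : R -> R) :
  (forall t, is_derive t (1 : R) f (df t)) ->
  forall (p : seq R) (x : R),
    path <%R x p -> {in x :: p, forall t, f t = 0} ->
  exists q : seq R,
    [/\ size q = size p, path <%R x q,
        {in q, forall t, t <= last x p} & {in q, forall t, df t = 0}].
Proof.
move=> fdf; elim=> [|y p IHp] x /=; first by move=> _ _; exists [::].
case/andP=> xy yp f0.
have [|q [szq yq qle dfq]] := IHp y yp.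
  by move=> t tp; apply: f0; rewrite in_cons tp orbT.
have [z zxy fz] : exists2 z, z \in `]x, y[ & is_derive z 1 f (0 : R).
  apply: Rolle => [//|t _||]; first exact: ex_derive.
  - by apply: derivable_within_continuous => t _; exact: ex_derive.
  - by rewrite !f0 ?mem_head// in_cons mem_head orbT.
move: zxy; rewrite in_itv /= => /andP[xz zy].
have ylast : y <= last y p.
  move: yp; rewrite (path_sortedE lt_trans) => /andP[/allP yp _].
  by have := mem_last y p; rewrite in_cons => /predU1P[->|/yp/ltW].
exists (z :: q); split => /=.
- by rewrite szq.
- rewrite xz /=; move: yq; case: (q) => //= a q' /andP[ya ->].
  by rewrite (lt_trans zy ya).
- move=> t; rewrite in_cons => /predU1P[->|/qle//].
  exact: le_trans (ltW zy) ylast.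
- move=> t; rewrite in_cons => /predU1P[->|/dfq//].
  have := fdf z => /(@derive_val _ _ _ _ _ _ _) <-.
  by rewrite derive_val.
Qed.

Lemma iterated_rolle (R : realType) (a b : R) (n : nat) (F : nat -> R -> R)
    (s : seq R) :
  (forall i t, is_derive t (1 : R) (F i) (F i.+1 t)) ->
  size s = n.+1 -> sorted <%R s -> {in s, forall t, a <= t <= b} ->
  {in s, forall t, F 0 t = 0} ->
  exists2 xi, a <= xi <= b & F n xi = 0.
Proof.
elim: n F s => [|n IHn] F [|x p]//= dF [szp] sp sab s0.
  by exists x; [apply: sab | apply: s0]; rewrite mem_head.
have [q [szq xq qle q0]] := rolle_path (dF 0) sp s0.
apply: (IHn (fun i => F i.+1) q) => //.
- by rewrite szq.
- exact: path_sorted xq.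
- move=> t tq; move: xq; rewrite (path_sortedE lt_trans) => /andP[/allP xq _].
  have /andP[ax _] := sab x (mem_head _ _).
  have /andP[_ lb] := sab _ (mem_last x p).
  by rewrite (le_trans ax (ltW (xq _ tq))) (le_trans (qle _ tq) lb).
Qed.

Definition lagrange (R : fieldType) (K : nat) (x : 'I_K -> R) (f : R -> R)
    : {poly R} :=
  \sum_(i < K) (f (x i) / \prod_(j < K | j != i) (x i - x j))
     *: \prod_(j < K | j != i) ('X - (x j)%:P).

Lemma lagrange_node (R : fieldType) (K : nat) (x : 'I_K -> R) (f : R -> R) i :
  injective x -> (lagrange x f).[x i] = f (x i).
Proof.
move=> injx; rewrite /lagrange horner_sum (bigD1 i)//= [X in _ + X]big1 ?addr0.
  rewrite hornerZ horner_prod.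
  under [X in _ * X = _]eq_bigr do rewrite hornerXsubC.
  rewrite divfK//; apply/prodf_neq0 => j ji.
  by rewrite subr_eq0 (inj_eq injx) eq_sym.
move=> j ji; rewrite hornerZ horner_prod [X in _ * X](bigD1 i) 1?eq_sym//=.
by rewrite hornerXsubC subrr mul0r mulr0.
Qed.

Lemma size_prod_XsubC_pred (R : idomainType) (K : nat) (P : pred 'I_K) (x : 'I_K -> R) :
  size (\prod_(j < K | P j) ('X - (x j)%:P)) = #|P|.+1.
Proof.
rewrite size_prod; last by move=> j _; rewrite polyXsubC_eq0.
under eq_bigr do rewrite size_XsubC.
by rewrite sum_nat_const muln2 -addnn subSn ?leq_addr// addnK.
Qed.

Lemma size_lagrange (R : fieldType) (K : nat) (x : 'I_K -> R) (f : R -> R) :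
  (size (lagrange x f) <= K)%N.
Proof.
apply: (leq_trans (size_sum _ _ _)); apply/bigmax_leqP => i _.
apply: (leq_trans (size_scale_leq _ _)); rewrite size_prod_XsubC_pred.
have := cardC1 i; rewrite card_ord => ->.
by rewrite prednK// (leq_ltn_trans _ (ltn_ord i)).
Qed.

Lemma derivn_monic (R : nzRingType) (p : {poly R}) (n : nat) :
  p \is monic -> size p = n.+1 -> p^`(n) = n`!%:R%:P.
Proof.
move=> /monicP pm szp; apply/polyP => i; rewrite coef_derivn coefC.
case: i => [|i]; last by rewrite nth_default ?mul0rn// szp addnS ltnS leq_addr.
by move: pm; rewrite addn0 ffactnn /lead_coef szp => ->.
Qed.

(** If [F 0] is [L] plus [la] times the node polynomial [W] at [y], then [F 0] and
    [L + la W] agree at [K + 1] distinct points, so their [K]-th derivatives, of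
    which the second is the constant [la K!], agree somewhere in [[0, 1]]. As
    [|W y| <= 1], the error [la W y] is at most [|la|]. *)
Lemma interpolation_error (R : realType) (K : nat) (F : nat -> R -> R)
    (x : 'I_K -> R) (B y : R) :
  (forall i t, is_derive t (1 : R) (F i) (F i.+1 t)) ->
  injective x -> (forall i, 0 <= x i <= 1) -> 0 <= y <= 1 ->
  (forall t, 0 <= t <= 1 -> `|F K t| <= B) ->
  `|F 0 y - (lagrange x (F 0)).[y]| <= B / K`!%:R.
Proof.
move=> dF injx x01 y01 FB.
have B0 : 0 <= B by rewrite (le_trans _ (FB y y01)).
have [/existsP[i /eqP yi]|] := boolP [exists i, y == x i].
  by rewrite yi lagrange_node// subrr normr0 divr_ge0.
rewrite negb_exists => /forallP ynx.
pose W : {poly R} := \prod_(j < K) ('X - (x j)%:P).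
have Wy : W.[y] = \prod_(j < K) (y - x j).
  by rewrite horner_prod; under eq_bigr do rewrite hornerXsubC.
have Wy0 : W.[y] != 0.
  by rewrite Wy; apply/prodf_neq0 => j _; rewrite subr_eq0.
pose L := lagrange x (F 0); pose la := (F 0 y - L.[y]) / W.[y].
pose Q := L + la *: W.
have QK : Q^`(K) = (la * K`!%:R)%:P.
  rewrite derivnD derivnZ (derivn_poly0 (size_lagrange x (F 0))) add0r.
  rewrite (derivn_monic (monic_prod_XsubC _ _ _)) ?scale_polyC//.
  by rewrite size_prod_XsubC_pred card_ord.
pose G i t := F i t - Q^`(i).[t].
have dG i t : is_derive t (1 : R) (G i) (G i.+1 t).
  by rewrite /G derivnS; apply: is_deriveB; exact: is_derive_poly.
have srt : perm_eq (sort <=%R (y :: codom x)) (y :: codom x) by rewrite perm_sort.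
have uq : uniq (y :: codom x).
  rewrite /= (map_inj_uniq injx) enum_uniq andbT.
  by apply/codomP => -[i yi]; have := ynx i; rewrite yi eqxx.
(* [G] vanishes at the [K + 1] points [y], [x 0], ..., [x (K - 1)]. *)
have [||||xi xi01] := @iterated_rolle R 0 1 K G (sort <=%R (y :: codom x)) dG.
- by rewrite size_sort /= size_codom card_ord.
- by rewrite sort_lt_sorted.
- move=> t; rewrite (perm_mem srt) in_cons => /predU1P[->//|/codomP[i ->]//].
- move=> t; rewrite (perm_mem srt) in_cons /G derivn0 /Q hornerD hornerZ => /predU1P[->|].
    by rewrite /la divfK//; ring.
  move=> /codomP[i ->]; rewrite lagrange_node// /W horner_prod (bigD1 i)//=.
  by rewrite hornerXsubC subrr mul0r mulr0 addr0 subrr.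
rewrite /G QK hornerC => /eqP; rewrite subr_eq0 => /eqP FK.
have K0 : 0 < K`!%:R :> R by rewrite ltr0n fact_gt0.
have lale : `|la| <= B / K`!%:R.
  by rewrite ler_pdivlMr// -[X in _ * X](gtr0_norm K0) -normrM -FK; exact: FB.
have -> : F 0 y - L.[y] = la * W.[y] by rewrite /la divfK.
rewrite normrM (le_trans _ lale)// ler_piMr// Wy normr_prod.
apply: prodr_ile1 => j _; rewrite normr_ge0/=.
by have := x01 j; move: y01; rewrite ler_norml; lra.
Qed.

(** On [[0, 1]] the numerators of the Lagrange basis are at most [1], so only
    the denominators, which are the products in the definition of [gamma],
    matter. *)
Lemma lagrange_bound (R : realFieldType) (K : nat) (x : 'I_K -> R) (f : R -> R)
    (e m y : R) :
  0 < e -> (forall i, 0 <= x i <= 1) -> 0 <= y <= 1 ->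
  (forall i, e < \prod_(j < K | j != i) `|x i - x j|) ->
  (forall i, `|f (x i)| <= m) ->
  `|(lagrange x f).[y]| <= K%:R * (m / e).
Proof.
move=> e0 x01 y01 ex fm; rewrite horner_sum.
apply: norm_sum_le => i.
have m0 : 0 <= m by rewrite (le_trans _ (fm i)).
rewrite hornerZ horner_prod normrM normf_div !normr_prod.
have P1 : \prod_(j < K | j != i) `|('X - (x j)%:P).[y]| <= 1.
  apply: prodr_ile1 => j _; rewrite normr_ge0/= hornerXsubC.
  by have := x01 j; move: y01; rewrite ler_norml; lra.
rewrite (le_trans (ler_piMr _ P1))//.
  by rewrite divr_ge0// prodr_ge0.
rewrite ler_pM ?invr_ge0 ?prodr_ge0// lef_pV2 ?posrE//; first exact: ltW.
exact: lt_trans (ex i).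
Qed.

Lemma separated_inj (R : realFieldType) (K : nat) (x : 'I_K -> R) (e : R) :
  0 < e -> (forall i, e < \prod_(j < K | j != i) `|x i - x j|) -> injective x.
Proof.
move=> e0 ex i j xij; apply/eqP; apply: contraT => nij.
have := ex i; rewrite (bigD1 j) 1?eq_sym//= xij subrr normr0 mul0r.
by rewrite ltNge ltW.
Qed.

(** * Discrete orthogonality of sines *)

(** Multiplying by the sine of half the step makes the sum telescope, and the
    two end terms agree by periodicity; that sine does not vanish since
    [0 < m < L]. *)
Lemma sum_cos_eq0 (R : realType) (L m : nat) : (0 < m < L)%N ->
  \sum_(j < L) cos (2 * pi * m%:R * (j%:R / L%:R)) = 0 :> R.
Proof.
move=> /andP[m0 mL]; have L0 : 0 < L%:R :> R by rewrite ltr0n (leq_trans _ mL).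
pose h : R := pi * (m%:R / L%:R).
have h0 : sin h != 0.
  rewrite gt_eqF// sin_gt0_pi// /h; apply/andP; split.
    by rewrite mulr_gt0 ?pi_gt0// divr_gt0// ltr0n.
  by rewrite gtr_pMr ?pi_gt0// ltr_pdivrMr// mul1r ltr_nat.
apply: (mulfI h0); rewrite mulr0 mulr_sumr.
pose g (j : nat) : R := sin (h * (2 * j%:R - 1)) / 2.
have step j : sin h * cos (2 * pi * m%:R * (j%:R / L%:R)) = g j.+1 - g j.
  have -> : 2 * pi * m%:R * (j%:R / L%:R) = h * (2 * j%:R) :> R.
    by rewrite /h; field; rewrite gt_eqF.
  rewrite /g -[j.+1]add1n natrD.
  rewrite (_ : h * (2 * (1%:R + j%:R) - 1) = h * (2 * j%:R) + h); last by ring.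
  by rewrite mulrBr mulr1 sinB sinD; field.
under eq_bigr => j _ do rewrite step.
rewrite -(big_mkord xpredT (fun j => g j.+1 - g j)) telescope_sumr//.
rewrite /g (_ : h * (2 * L%:R - 1) = - h + pi *+ 2 *+ m); last first.
  by rewrite /h -mulr_natr -[pi *+ 2]mulr_natr; field; rewrite gt_eqF.
by rewrite periodicn; [rewrite mulr0 sub0r mulrN1 subrr | exact: sinD2pi].
Qed.

Lemma sine_orthogonal (R : realType) (L k l : nat) :
  (0 < k)%N -> (0 < l)%N -> (k + l < L)%N ->
  \sum_(j < L) sin (2 * pi * k%:R * (j%:R / L%:R))
             * sin (2 * pi * l%:R * (j%:R / L%:R)) = (L%:R / 2) *+ (k == l) :> R.
Proof.
move=> k0 l0 klL.
wlog kl : k l k0 l0 klL / (l <= k)%N.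
  move=> H; have [/H->//|/ltnW lk] := leqP l k.
  by rewrite eq_sym -(H l k)// 1?addnC//; apply: eq_bigr => j _; rewrite mulrC.
have prodE j : sin (2 * pi * k%:R * (j%:R / L%:R)) * sin (2 * pi * l%:R * (j%:R / L%:R))
    = (cos (2 * pi * (k - l)%:R * (j%:R / L%:R))
       - cos (2 * pi * (k + l)%:R * (j%:R / L%:R))) / 2 :> R.
  rewrite natrB// natrD.
  set A := _ * k%:R * _; set B := _ * l%:R * _.
  rewrite (_ : _ * (k%:R - l%:R) * _ = A - B); last by rewrite mulrBr mulrBl.
  rewrite (_ : _ * (k%:R + l%:R) * _ = A + B); last by rewrite mulrDr mulrDl.
  by rewrite cosB cosD; field.
under eq_bigr => j _ do rewrite prodE.
rewrite -mulr_suml sumrB (@sum_cos_eq0 R L (k + l)) ?subr0 ?klL ?addn_gt0 ?k0//.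
have [->|nkl] := eqVneq k l.
  under eq_bigr do rewrite subnn mulr0 mul0r cos0.
  by rewrite sumr_const card_ord mulr1n.
rewrite sum_cos_eq0 ?mul0r// subn_gt0 ltn_neqAle eq_sym nkl kl /=.
by rewrite (leq_ltn_trans _ klL)// (leq_trans (leq_subr _ _))// leq_addr.
Qed.

(** A grid of [2N + 1] points is just fine enough: two frequencies in [1, ..., N] add up
    to less than [2N + 1], so no aliasing occurs and each coefficient is a
    discrete inner product of [f] with a sine. *)
Lemma sine_coef_bound (R : realType) (N : nat) (a : 'I_N -> R) (M : R) :
  let f t := \sum_(k < N) a k * sin (2 * pi * k.+1%:R * t) in
  (forall j : 'I_(2 * N).+1, `|f (j%:R / (2 * N).+1%:R)| <= M) ->
  forall k, `|a k| <= 2 * M.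
Proof.
move=> f fM k; set L := (2 * N).+1 in fM *.
have L0 : 0 < L%:R :> R by rewrite ltr0n.
have term l : \sum_(j < L) a l * sin (2 * pi * l.+1%:R * (j%:R / L%:R))
                 * sin (2 * pi * k.+1%:R * (j%:R / L%:R))
    = a l * ((L%:R / 2) *+ (l == k)).
  rewrite (_ : (l == k) = (l.+1 == k.+1)%N)// -sine_orthogonal//; last first.
    by rewrite /L ltnS mul2n -addnn leq_add.
  by rewrite mulr_sumr; apply: eq_bigr => j _; rewrite mulrA.
have akE : a k * (L%:R / 2)
    = \sum_(j < L) f (j%:R / L%:R) * sin (2 * pi * k.+1%:R * (j%:R / L%:R)).
  under eq_bigr do rewrite mulr_suml.
  rewrite exchange_big /= (bigD1 k)//= term eqxx [X in _ + X]big1 ?addr0// => l lk.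
  by rewrite term (negbTE lk) mulr0.
have : `|a k| * (L%:R / 2) <= L%:R * M.
  rewrite -[X in _ * X]gtr0_norm ?divr_gt0// -normrM akE.
  apply: norm_sum_le => j.
  rewrite normrM (le_trans (ler_piMr _ _) (fM j))// ler_norml sin_geN1 sin_le1//.
by rewrite mulrCA ler_pM2l// ler_pdivrMr// mulrC.
Qed.

(** * Separated points from the hypothesis on gamma *)

(** The bound [s] is uniform in [k], and this gap below [l] is what later allows an
    exponent strictly between the limit superior and [2]. *)
Lemma limn_esup_lt_eventually (R : realType) (u : (\bar R)^nat) (l : \bar R) :
  (limn_esup u < l)%E ->
  exists n, exists2 s : \bar R, (s < l)%E & forall k, (n <= k)%N -> (u k <= s)%E.
Proof.
rewrite limn_esup_lim (cvg_lim (@ereal_hausdorff R) (@cvg_esups_inf R u)).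
move=> /ereal_inf_lt[_ [n _ <-] nl]; exists n, (esups u n) => // k nk.
by apply: ereal_sup_ubound; exists k.
Qed.

(** As [e] is positive, [gamma] is not the default value that [sup] takes on
    the empty set, so the supremum is approached by actual point
    configurations. *)
Lemma gamma_points (R : realType) (E : set R) (k : nat) (e : R) :
  0 < e -> e < gamma E k ->
  exists2 x : 'I_k -> R, forall i, E (x i) &
    forall i, e < \prod_(j < k | j != i) `|x i - x j|.
Proof.
move=> e0; rewrite /gamma; set S := [set _ | _ in _] => eS.
have S0 : S !=set0.
  by apply/set0P/eqP => S0; move: eS; rewrite S0 sup0 ltNge ltW.
have [_ [x Ex <-] ex] := sup_gt S0 eS.
exists x => // i; apply: lt_le_trans ex _; exact: bigmin_le.
Qed.

(** This undoes both logarithms. If [gamma] vanishes, then the ratio is [+oo], so the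
    inequality on the ratio excludes this case. *)
Lemma loglog_ratio_lt_gamma (R : realType) (E : set R) (k : nat) (alpha : R) :
  (1 < k)%N -> (loglog_ratio E k < alpha%:E)%E ->
  expR (- (k%:R `^ alpha)) < gamma E k.
Proof.
move=> k1; have k0 : 0 < k%:R :> R by rewrite ltr0n ltnW.
have lnk : 0 < ln (k%:R : R) by rewrite ln_gt0// ltr1n.
rewrite ltNge => /negP lt_alpha; rewrite ltNge; apply/negP => gle; apply: lt_alpha.
rewrite /loglog_ratio.
have P0 : 0 < k%:R `^ alpha :> R by rewrite powR_gt0.
suff : ((alpha * ln (k%:R : R))%:E <= lne (- lne (gamma E k)%:E))%E.
  move=> H; have -> : alpha%:E = ((alpha * ln (k%:R : R))%:E * ((ln (k%:R : R))^-1)%:E)%E.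
    by rewrite -EFinM mulfK// gt_eqF.
  by apply: lee_wpmul2r => //; rewrite lee_fin invr_ge0 ltW.
have [g0|g0] := leP (gamma E k) 0.
  by rewrite (le0_lneNy (x := (gamma E k)%:E)) ?lee_fin//= leey.
have Pg : k%:R `^ alpha <= - ln (gamma E k).
  by rewrite lerNr -[leRHS]expRK ler_ln// posrE expR_gt0.
rewrite lne_EFin// -EFinN lne_EFin ?(lt_le_trans P0)// lee_fin -ln_powR.
by rewrite ler_ln// posrE (lt_le_trans P0).
Qed.

(** Asking for [1 <= alpha] costs nothing, as the bound weakens when [alpha] grows, and
    it makes [K] and the other polynomial factors smaller than
    [expR (K^alpha)]. *)
Lemma separated_points (R : realType) (E : set R) :
  (limn_esup (loglog_ratio E) < 2%:E)%E ->
  exists (alpha : R) (k0 : nat), 1 <= alpha < 2 /\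
    forall k, (k0 <= k)%N -> exists2 x : 'I_k -> R, forall i, E (x i) &
      forall i, expR (- (k%:R `^ alpha)) < \prod_(j < k | j != i) `|x i - x j|.
Proof.
move=> /limn_esup_lt_eventually[n [s s2 us]].
have [alpha a12 sa] : exists2 alpha : R, 1 <= alpha < 2 & (s < alpha%:E)%E.
  case: s s2 {us} => [r| |] //=; last by exists 1; [lra | rewrite ltNyr].
  rewrite lte_fin => r2; exists (Num.max 1 ((r + 2) / 2)).
    by rewrite le_max lexx/= gt_max; apply/andP; split; lra.
  by rewrite lte_fin lt_max; apply/orP; right; lra.
exists alpha, (maxn n 2); split=> // k; rewrite geq_max => /andP[nk k1].
apply: gamma_points; first exact: expR_gt0.
by apply: loglog_ratio_lt_gamma => //; exact: le_lt_trans (us k nk) sa.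
Qed.

(** * Propagation for real sine sums *)

(** The [i]-th derivative of a sine sum. The phase shift [i pi / 2] keeps all orders
    in the sine family, without a case distinction on [i] modulo [4]. *)
Definition sine_derivative (R : realType) (N : nat) (a : 'I_N -> R) (i : nat) (t : R) : R :=
  \sum_(k < N) a k * (2 * pi * k.+1%:R) ^+ i
    * sin (2 * pi * k.+1%:R * t + i%:R * (pi / 2)).

Lemma is_derive_sine_derivative (R : realType) (N : nat) (a : 'I_N -> R) i (t : R) :
  is_derive t (1 : R) (sine_derivative a i) (sine_derivative a i.+1 t).
Proof.
pose h k (t : R) := a k * (2 * pi * k.+1%:R) ^+ i
    * sin (2 * pi * k.+1%:R * t + i%:R * (pi / 2)).
have -> : sine_derivative a i = \sum_(k < N) h k by apply/funext => u; rewrite fct_sumE.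
apply: is_derive_sum => k; rewrite /h.
set c := 2 * pi * _; set d := i%:R * _.
have -> : (fun t => a k * c ^+ i * sin (c * t + d)) =
   (a k * c ^+ i) *: (sin \o (c *: id + cst d)) by apply/funext.
apply: is_derive_eq.
rewrite /= ?addr0 -nat1r mulrDl mul1r exprS.
rewrite (_ : c * t + (pi / 2 + _) = c * t + d + pi / 2); last by rewrite /d; ring.
rewrite sinDpihalf /GRing.scale /=; ring.
Qed.

Lemma expR1_le4 (R : realType) : expR 1 <= 4 :> R.
Proof.
have := @expR_ge1Dx R (- (1/2)); rewrite expRN => h.
have e0 := expR_gt0 (1/2 : R).
have h2 : expR (1/2) <= 2 :> R.
  by rewrite -lef_pV2 ?posrE//; lra.
rewrite (_ : (1 : R) = 1/2 + 1/2) ?expRD; last lra.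
by nra.
Qed.

(** With [K^K / K! <= e^K <= 4^K] and [2 pi N <= 8 N <= K / 8], the quotient
    [(2 pi N)^K / K!] is at most [2^-K], and [2^K >= K >= 4 N] turns the remaining
    factor [2 N] into [1 / 2]. *)
Lemma interpolation_tail_le_half (R : realType) (N K : nat) : (0 < N)%N -> (64 * N <= K)%N ->
  N%:R * (2 * (2 * pi * N%:R) ^+ K) / K`!%:R <= 1 / 2 :> R.
Proof.
move=> N0 NK; have K0 : (0 < K)%N by rewrite (leq_trans _ NK)// muln_gt0 N0.
have KR : 64 * N%:R <= K%:R :> R by rewrite -natrM ler_nat.
have NR : 0 < N%:R :> R by rewrite ltr0n.
have F0 : 0 < K`!%:R :> R by rewrite ltr0n fact_gt0.
have pi4 : pi < 4 :> R by have := @pihalf_lt2 R; lra.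
have pi0 := @pi_gt0 R.
have fac : K%:R ^+ K / K`!%:R <= 4 ^+ K :> R.
  have := @expR_ge1Dxn R K%:R K.-1 (ler0n _ _); rewrite prednK// => h.
  have : K%:R ^+ K / K`!%:R <= expR K%:R :> R by lra.
  move=> /le_trans; apply; rewrite -[K%:R]mulr1 mulrC expRM_natr.
  by rewrite lerXn2r ?nnegrE ?expR_ge0// expR1_le4.
have base : (2 * pi * N%:R) ^+ K <= K%:R ^+ K / 8 ^+ K :> R.
  rewrite -expr_div_n lerXn2r ?nnegrE//; nra.
have two : 4 * N%:R <= 2 ^+ K :> R.
  rewrite -natrX -natrM ler_nat (leq_trans _ (ltnW (ltn_expl _ _)))//.
  by rewrite (leq_trans _ NK)// leq_mul2r orbT.
have E8 : 8 ^+ K = 2 ^+ K * 4 ^+ K :> R by rewrite -exprMn; congr (_ ^+ _); lra.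
have P2 : 0 < 2 ^+ K :> R by rewrite exprn_gt0.
have P4 : 0 < 4 ^+ K :> R by rewrite exprn_gt0.
have step : (2 * pi * N%:R) ^+ K / K`!%:R <= (2 ^+ K)^-1 :> R.
  have /le_trans : (2 * pi * N%:R) ^+ K / K`!%:R <= K%:R ^+ K / 8 ^+ K / K`!%:R :> R.
    by rewrite ler_pM2r// invr_gt0.
  apply; rewrite mulrAC E8 ler_pdivrMr ?mulr_gt0//.
  by rewrite mulrA mulVf ?mul1r// gt_eqF.
have -> : N%:R * (2 * (2 * pi * N%:R) ^+ K) / K`!%:R
    = N%:R * 2 * ((2 * pi * N%:R) ^+ K / K`!%:R) :> R by rewrite !mulrA.
apply: (le_trans (ler_wpM2l _ step)); first by rewrite mulr_ge0.
by rewrite ler_pdivrMr//; lra.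
Qed.

(** The bound is first obtained for the grid maximum [M]: by interpolation at the
    nodes it is at most [K m / e] plus the error [M / 2]. The coefficients, and so
    [f] on all of [R], are then bounded in terms of [M]. *)
Lemma real_sine_propagation (R : realType) (N K : nat) (a : 'I_N -> R)
    (x : 'I_K -> R) (e m : R) :
  let f t := \sum_(k < N) a k * sin (2 * pi * k.+1%:R * t) in
  (0 < N)%N -> (64 * N <= K)%N -> 0 < e -> (forall i, 0 <= x i <= 1) ->
  (forall i, e < \prod_(j < K | j != i) `|x i - x j|) ->
  (forall i, `|f (x i)| <= m) ->
  forall t, `|f t| <= 4 * N%:R * K%:R * (m / e).
Proof.
move=> f N0 NK e0 x01 ex fm t.
have injx := separated_inj e0 ex.
have fE u : sine_derivative a 0 u = f u.
  by apply: eq_bigr => k _; rewrite expr0 mulr1 mul0r addr0.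
pose L := (2 * N).+1; pose grid (j : 'I_L) : R := j%:R / L%:R.
have grid01 j : 0 <= grid j <= 1.
  rewrite /grid divr_ge0//= ler_pdivrMr ?ltr0n// mul1r ler_nat.
  exact/ltnW/ltn_ord.
pose j0 := [arg max_(j > (ord0 : 'I_L)) `|f (grid j)|]%O.
pose M := `|f (grid j0)|.
have maxM j : `|f (grid j)| <= M.
  by rewrite /M /j0; case: arg_maxP => // i _; exact.
have aM k : `|a k| <= 2 * M by exact: sine_coef_bound maxM k.
have M0 : 0 <= M by rewrite /M.
have pi0 := @pi_gt0 R.
have FK u : `|sine_derivative a K u| <= N%:R * (2 * M * (2 * pi * N%:R) ^+ K).
  apply: norm_sum_le => k; rewrite !normrM.
  apply: (le_trans (ler_piMr _ _)); first by rewrite mulr_ge0.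
    by rewrite ler_norml sin_geN1 sin_le1.
  rewrite ler_pM// normrX lerXn2r ?nnegrE ?mulr_ge0 ?(ltW pi0)//.
  rewrite ger0_norm ?mulr_ge0 ?(ltW pi0)// ler_wpM2l ?mulr_ge0 ?(ltW pi0)//.
  by rewrite ler_nat ltn_ord.
have err := interpolation_error (@is_derive_sine_derivative R N a) injx x01
  (grid01 j0) (fun u _ => FK u).
have lag : `|(lagrange x (sine_derivative a 0)).[grid j0]| <= K%:R * (m / e).
  by apply: lagrange_bound => // i; rewrite fE.
have tail := @interpolation_tail_le_half R N K N0 NK.
have MM : M <= 2 * (K%:R * (m / e)).
  have half : N%:R * (2 * M * (2 * pi * N%:R) ^+ K) / K`!%:R <= M / 2.
    rewrite (_ : _ / K`!%:R = M * (N%:R * (2 * (2 * pi * N%:R) ^+ K) / K`!%:R)).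
      by rewrite (le_trans (ler_wpM2l M0 tail))// mul1r.
    by ring.
  have := ler_normD (sine_derivative a 0 (grid j0) - (lagrange x (sine_derivative a 0)).[grid j0])
    (lagrange x (sine_derivative a 0)).[grid j0].
  rewrite subrK fE -/M => h.
  by move: err lag half h; rewrite fE; lra.
apply: (@le_trans _ _ (N%:R * (2 * M))).
  apply: norm_sum_le => k; rewrite normrM (le_trans (ler_piMr _ _) (aM k))//.
  by rewrite ler_norml sin_geN1 sin_le1.
have -> : 4 * N%:R * K%:R * (m / e) = N%:R * (2 * (2 * (K%:R * (m / e)))) by ring.
by rewrite ler_wpM2l// ler_pM2l.
Qed.

(** * From real to complex coefficients *)

Lemma normc_ge0 (R : rcfType) (z : R[i]) : 0 <= Normc.normc z.
Proof. by case: z => a b; exact: sqrtr_ge0. Qed.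

Lemma normc_real (R : rcfType) (x : R) : Normc.normc (x%:C)%C = `|x|.
Proof. by rewrite /= expr0n /= addr0 sqrtr_sqr. Qed.

Lemma normc_ge_Re (R : rcfType) (z : R[i]) : `|complex.Re z| <= Normc.normc z.
Proof.
by case: z => a b /=; rewrite -sqrtr_sqr; apply: ler_wsqrtr; rewrite lerDl sqr_ge0.
Qed.

Lemma normc_ge_Im (R : rcfType) (z : R[i]) : `|complex.Im z| <= Normc.normc z.
Proof.
by case: z => a b /=; rewrite -sqrtr_sqr; apply: ler_wsqrtr; rewrite lerDr sqr_ge0.
Qed.

Lemma normc_le_ReIm (R : rcfType) (z : R[i]) :
  Normc.normc z <= `|complex.Re z| + `|complex.Im z|.
Proof.
case: z => a b /=.
rewrite -[leRHS](ger0_norm (addr_ge0 (normr_ge0 a) (normr_ge0 b))) -[leRHS]sqrtr_sqr.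
apply: ler_wsqrtr.
rewrite sqrrD !real_normK ?num_real// -addrA lerD2l lerDr.
by rewrite mulrn_wge0// mulr_ge0.
Qed.

Lemma Re_sum (R : rcfType) (n : nat) (c : 'I_n -> R[i]) (s : 'I_n -> R) :
  complex.Re (\sum_(k < n) c k * (s k)%:C%C) = \sum_(k < n) complex.Re (c k) * s k.
Proof.
elim/big_rec2: _ => // k u v _ <-; case: (c k) v => p q [v1 v2] /=.
by rewrite mulr0 subr0.
Qed.

Lemma Im_sum (R : rcfType) (n : nat) (c : 'I_n -> R[i]) (s : 'I_n -> R) :
  complex.Im (\sum_(k < n) c k * (s k)%:C%C) = \sum_(k < n) complex.Im (c k) * s k.
Proof.
elim/big_rec2: _ => // k u v _ <-; case: (c k) v => p q [v1 v2] /=.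
by rewrite mulr0 add0r.
Qed.

(** The frequency [0] contributes nothing to the sum, so the frequencies are
    renumbered from [1]; this is needed because the coefficient of frequency [0]
    is not determined by the values of the sum. *)
Lemma sine_sumE (R : realType) (Lambda : R) (c : nat -> R[i]) (x : R) :
  1 <= Lambda ->
  sine_sum Lambda c x = \sum_(k < Num.truncn (Num.sqrt Lambda))
     c k.+1 * (sin (2 * pi * k.+1%:R * x))%:C%C.
Proof.
move=> L1; have L0 : 0 <= Lambda by lra.
set N := Num.truncn _; rewrite /sine_sum.
have -> : [set k : nat | k%:R ^+ 2 <= Lambda] = `I_N.+1.
  apply/seteqP; split => k /=; rewrite ltnS truncn_ge_nat ?sqrtr_ge0//.
    by move=> kL; rewrite -[leLHS]ger0_norm// -sqrtr_sqr; exact: ler_wsqrtr.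
  by move=> kL; rewrite -[leRHS]sqr_sqrtr// lerXn2r ?nnegrE ?sqrtr_ge0.
rewrite -fsbig_ord big_ord_recl /= mulr0 mul0r sin0.
rewrite (_ : (0 : R)%:C%C = 0)// mulr0 add0r.
by apply: eq_bigr.
Qed.

Lemma sine_sum_propagation (R : realType) (Lambda : R) (c : nat -> R[i]) (K : nat)
    (x : 'I_K -> R) (e m : R) (N := Num.truncn (Num.sqrt Lambda)) :
  1 <= Lambda -> (64 * N <= K)%N -> 0 < e -> (forall i, 0 <= x i <= 1) ->
  (forall i, e < \prod_(j < K | j != i) `|x i - x j|) ->
  (forall i, Normc.normc (sine_sum Lambda c (x i)) <= m) ->
  forall t, Normc.normc (sine_sum Lambda c t) <= 8 * N%:R * K%:R * (m / e).
Proof.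
move=> L1 NK e0 x01 ex vm t.
have N0 : (0 < N)%N by rewrite truncn_gt0 -sqrtr1; exact: ler_wsqrtr.
have re := @real_sine_propagation R N K (fun k => complex.Re (c k.+1)) x e m N0 NK e0 x01 ex.
have im := @real_sine_propagation R N K (fun k => complex.Im (c k.+1)) x e m N0 NK e0 x01 ex.
rewrite (le_trans (normc_le_ReIm _))//.
have -> : 8 * N%:R * K%:R * (m / e)
   = 4 * N%:R * K%:R * (m / e) + 4 * N%:R * K%:R * (m / e) by ring.
rewrite lerD//.
  rewrite sine_sumE// Re_sum; apply: re => i.
  by rewrite -Re_sum -sine_sumE// (le_trans (normc_ge_Re _)).
rewrite sine_sumE// Im_sum; apply: im => i.
by rewrite -Im_sum -sine_sumE// (le_trans (normc_ge_Im _)).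
Qed.

(** A supremum of reals is an upper bound only for a bounded set; here the
    sum of the moduli of the coefficients is a bound. *)
Lemma sine_sum_bounded (R : realType) (Lambda : R) (c : nat -> R[i]) (A : set R) :
  1 <= Lambda -> has_ubound [set Normc.normc (sine_sum Lambda c x) | x in A].
Proof.
move=> L1; exists (\sum_(k < Num.truncn (Num.sqrt Lambda)) Normc.normc (c k.+1)).
move=> _ [x _ <-]; rewrite sine_sumE//.
elim/big_rec2: _ => [|k u v _ vu]; first by rewrite Normc.normc0.
rewrite (le_trans (le_normcD _ _))// lerD// Normc.normcM normc_real.
by rewrite ler_piMr ?normc_ge0// ler_norml sin_geN1 sin_le1.
Qed.

Lemma normc_le_sup_norm_on (R : realType) (Lambda : R) (c : nat -> R[i]) (A : set R) x :
  1 <= Lambda -> A x ->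
  Normc.normc (sine_sum Lambda c x) <= sup_norm_on A (sine_sum Lambda c).
Proof.
by move=> L1 Ax; apply: ub_le_sup; [exact: sine_sum_bounded | exists x].
Qed.

(** * The exponential bound *)

(** With [P = K^alpha >= K], the polynomial factor [8 N K <= 8 P^2] is at most
    [expR P ^+ 4], because [expR P >= 1 + P] gives [expR P ^+ 2 >= 4 P]. *)
Lemma interpolation_constant_le_exp (R : realType) (K N : nat) (alpha : R) :
  1 <= alpha -> (0 < N)%N -> (N <= K)%N ->
  8 * N%:R * K%:R / expR (- (K%:R `^ alpha)) <= expR (5 * K%:R `^ alpha) :> R.
Proof.
move=> a1 N0 NK; set P := K%:R `^ alpha.
have KP : K%:R <= P :> R by apply: le1r_powR => //; rewrite ler1n (leq_trans N0).
have K1 : 1 <= K%:R :> R by rewrite ler1n (leq_trans N0).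
have NKR : N%:R <= K%:R :> R by rewrite ler_nat.
rewrite expRN invrK (_ : 5 * P = P + P + P + P + P); last by ring.
rewrite !expRD ler_pM2r ?expR_gt0//.
have e1 := @expR_ge1Dx R P.
have N1 : 0 <= N%:R :> R by [].
have P1 : 1 <= P by lra.
have NKP : N%:R * K%:R <= P * P by apply: ler_pM => //; lra.
have ee : 4 * P <= expR P * expR P by nra.
have P4 : 0 <= 4 * P by lra.
have := ler_pM P4 P4 ee ee.
rewrite !mulrA => e4; apply: le_trans e4; nra.
Qed.

Theorem corollary3p5 (R : realType) (omega : set R)
    (omega01 : omega `<=` `[0, 1])
    (hgamma : (limn_esup (loglog_ratio omega) < 2%:E)%E) :
  exists C beta : R,
    [/\ 0 < C, 0 < beta, beta < 1 &
      forall (Lambda : R) (c : nat -> R[i]), 1 <= Lambda ->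
        sup_norm_on `[0, 1] (sine_sum Lambda c) <=
          expR (C * Lambda `^ beta) * sup_norm_on omega (sine_sum Lambda c)].
Proof.
have [alpha [k0 [/andP[a1 a2] points]]] := separated_points hgamma.
(* The summand [64] makes the interpolation error small; adding [k0] ensures
   [K >= k0] for [K = (64 + k0) N], since [N >= 1]. *)
pose A : R := (64 + k0)%:R.
exists (5 * A `^ alpha), (alpha / 2); split.
- by rewrite mulr_gt0// powR_gt0// /A ltr0n.
- lra.
- lra.
move=> Lambda c L1.
pose N := Num.truncn (Num.sqrt Lambda); pose K := ((64 + k0) * N)%N.
have N0 : (0 < N)%N by rewrite truncn_gt0 -sqrtr1; exact: ler_wsqrtr.
have NK : (64 * N <= K)%N by rewrite leq_mul2r leq_addr orbT.
have kK : (k0 <= K)%N.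
  by rewrite (leq_trans (leq_addl 64 k0))// leq_pmulr.
have [x xo ex] := points K kK.
set e := expR _ in ex.
have e0 : 0 < e by exact: expR_gt0.
have x01 i : 0 <= x i <= 1.
  by have := omega01 _ (xo i); rewrite /= in_itv.
pose m := sup_norm_on omega (sine_sum Lambda c).
have vm i : Normc.normc (sine_sum Lambda c (x i)) <= m by exact: normc_le_sup_norm_on.
have m0 : 0 <= m.
  have K0 : (0 < K)%N by rewrite (leq_trans _ NK)// muln_gt0 N0.
  exact: le_trans (normc_ge0 _) (vm (Ordinal K0)).
apply: ge_sup => [|_ [t _ <-]].
  by apply: image_nonempty; exists 0; rewrite /= in_itv/= lexx ler01.
apply: (le_trans (sine_sum_propagation L1 NK e0 x01 ex vm t)).
rewrite mulrCA mulrC ler_wpM2r//.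
have KN : (N <= K)%N by rewrite (leq_trans _ NK)// leq_pmull.
apply: (le_trans (interpolation_constant_le_exp a1 N0 KN)).
rewrite ler_expR -mulrA ler_pM2l//.
have L0 : 0 <= Lambda by lra.
have A0 : 0 <= A by [].
have -> : Lambda `^ (alpha / 2) = Num.sqrt Lambda `^ alpha.
  by rewrite -powR12_sqrt// powRrM powRAC.
rewrite -powRM ?sqrtr_ge0//; apply: ge0_ler_powR; rewrite ?nnegrE ?mulr_ge0 ?sqrtr_ge0//.
  lra.
by rewrite /K natrM ler_wpM2l// truncn_le sqrtr_ge0.
Qed.
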